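(* For every integer $m\in\mathbb Z$, $m\neq 0$, let $\tau_m(I)=I+m\,|I|$ for all $I\in\mathscr D\cup\sigma(\mathscr D)$. Then there exist a non-negative integer $K(m)\le 7+2\log_2(|m|)$ and pairwise disjoint collections of dyadic intervals $\mathscr B_i^{(\delta)}\subset\mathscr D$, $0\le i\le K(m)$, $\delta\in\{0,1\}$, with $$\mathscr D=\bigcup_{\delta\in\{0,1\}}\ \bigcup_{i=0}^{K(m)}\mathscr B_i^{(\delta)},$$ such that for all $0\le i\le K(m)$ and $\delta\in\{0,1\}$ the collection of sets $$\big\{\,I,\ \tau_m(I),\ I\cup\tau_m(I)\ :\ I\in\sigma^\delta(\mathscr B_i^{(\delta)})\,\big\}$$ is nested.
   Context: For $j\in\mathbb Z$ let $\mathscr D_j=\{[2^{-j}k,2^{-j}(k+1)[\ :k\in\mathbb Z\}$ and $\mathscr D=\bigcup_{j\in\mathbb Z}\mathscr D_j$ (the dyadic intervals of $\mathbb R$). $|I|$ denotes the length of $I$, and $I+c$ the translate of $I$ by $c\in\mathbb R$. The one-third-shift map is $\sigma(I)=I+s(I)$, where $s(I)=(-1)^j2^{-j}/3$ if $|I|=2^{-j}$; $\sigma(\mathscr B)=\{\sigma(I):I\in\mathscr B\}$ for $\mathscr B\subset\mathscr D$. By convention $\sigma^0=\mathrm{Id}$ and $\sigma^1=\sigma$. A collection of sets is nested if any two of its members are either disjoint or one is contained in the other. *)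

(* Defs.v *)
From mathcomp Require Import all_boot all_order all_algebra.
From mathcomp Require Import all_classical all_reals all_analysis.

Set Implicit Arguments.
Unset Strict Implicit.
Unset Printing Implicit Defensive.

Import Order.TTheory GRing.Theory Num.Theory.

Local Open Scope classical_set_scope.
Local Open Scope ring_scope.

(* A collection of sets of reals has type [set (set R)]; a dyadic interval is
   the set of its points. *)

Definition dyadic_level (R : realType) (j : int) : set (set R) :=
  [set I | exists k : int,
     I = `[2 ^ (- j) * k%:~R, 2 ^ (- j) * (k%:~R + 1)[%classic].

Definition dyadic (R : realType) : set (set R) :=
  \bigcup_(j in [set: int]) @dyadic_level R j.

Definition length (R : realType) (I : set R) : R := fine (lebesgue_measure I).

Definition translate (R : realType) (I : set R) (c : R) : set R :=
  [set x + c | x in I].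

(* The exponent j with |I| = 2^-j is unique when it exists, so [xget] returns
   the intended value; sets whose length is not a power of 2 get the junk
   value 0. *)
Definition third_shift (R : realType) (I : set R) : R :=
  xget 0 [set s : R | exists2 j : int,
            length I = 2 ^ (- j) & s = (-1) ^ j * 2 ^ (- j) / 3].

Definition sigma (R : realType) (I : set R) : set R :=
  translate I (third_shift I).

Definition tau (R : realType) (m : int) (I : set R) : set R :=
  translate I (m%:~R * length I).

Definition nested (T : Type) (F : set (set T)) : Prop :=
  forall A B : set T, F A -> F B ->
    A `&` B = set0 \/ A `<=` B \/ B `<=` A.

Definition with_translates (R : realType) (m : int) (F : set (set R)) :
    set (set R) :=
  [set A | exists2 I : set R, F I & A = I \/ A = tau m I \/ A = I `|` tau m I].

Definition log2 (R : realType) (x : R) : R := ln x / ln 2.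

(* Main.v *)
Require Import Defs.
From mathcomp Require Import all_boot all_order all_algebra.
From mathcomp Require Import all_classical all_reals all_analysis.
From mathcomp Require Import ring lra zify.

Set Implicit Arguments.
Unset Strict Implicit.
Unset Printing Implicit Defensive.

Import Order.TTheory GRing.Theory Num.Theory.

Local Open Scope classical_set_scope.
Local Open Scope ring_scope.

(** Write n for the absolute value of m and choose p with 2^p > 3n.  The
    dyadic grid and its one-third shift are both nested families of cells, and
    on level j - p (cells 2^p times longer than those of level j) the endpoints
    of the one are at distance at least (2^p - 1)/3 >= n, in units of 2^-j,
    from the endpoints of the other.  A window of n + 1 consecutive cells of
    level j has only n interior endpoints, so it cannot be cut by level j - p
    in both grids at once: for one of the two values of delta, both
    sigma^delta(I) and its translate by tau_m lie in a common cell of level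
    j - p ([fits_shifted]).  This choice of delta is one half of the
    classification of the intervals.

    The other half is a colour: the level j modulo p together with the parity
    of the quotient of k by m, where I = [2^-j k, 2^-j (k+1)[.  Take two
    intervals of the same class.  If their levels differ, they differ by at
    least p, so the finer interval and its translate lie in one cell of the
    coarser level, and a cell of that level is either contained in or disjoint
    from each of the three sets attached to the coarser interval
    ([nested_finer]).  If the levels agree, the parity forbids that the indices
    differ by m, so the four cells involved are pairwise disjoint unless the
    intervals coincide ([nested_same_level]).

    There are 2p colours, and for p = 3 + floor(log2 n) we have 2^p > 4n and
    2p - 1 <= 5 + 2 log2 n. *)

(** * The dyadic grid and its one-third shift *)

(** Displacement of the grid at level j, in units of 2^-j; the boolean selects
    the plain (false) or the shifted (true) grid. *)
Definition offset (R : realType) (d : bool) (j : int) : R :=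
  d%:R * (-1) ^ j / 3.

Definition cell (R : realType) (d : bool) (j k : int) : set R :=
  `[2 ^ (- j) * (k%:~R + offset R d j),
    2 ^ (- j) * (k%:~R + 1 + offset R d j)[%classic.

Arguments offset R d j : clear implicits.
Arguments cell R d j k : clear implicits.

Lemma dyadicE (R : realType) :
  @dyadic R = [set I | exists j k : int, I = cell R false j k].
Proof.
apply/seteqP; split=> I.
  by move=> [j _ [k ->]]; exists j, k; rewrite /cell /offset !mul0r !addr0.
move=> [j [k ->]]; exists j => //; exists k.
by rewrite /cell /offset !mul0r !addr0.
Qed.

(** Membership read in the coordinate whose unit is one cell: k is the floor of
    2^j x - offset.  All inclusions between cells reduce to integer
    inequalities through this form. *)
Lemma in_cell (R : realType) d (j k : int) (x : R) :
  cell R d j k x <-> k%:~R <= 2 ^ j * x - offset R d j < k%:~R + 1.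
Proof.
have p2 : (0 : R) < 2 ^ j by apply: exprz_gt0.
rewrite /cell /= in_itv /= -invr_expz ![_^-1 * _]mulrC.
rewrite ler_pdivrMr // ltr_pdivlMr // [x * _]mulrC.
by rewrite lerBrDr ltrBlDr.
Qed.

Lemma cell_index (R : realType) d (j k l : int) (x : R) :
  cell R d j k x -> cell R d j l x -> k = l.
Proof.
move=> /in_cell/andP[k1 k2] /in_cell/andP[l1 l2].
have : (k%:~R : R) < l%:~R + 1 by lra.
have : (l%:~R : R) < k%:~R + 1 by lra.
by rewrite -!intrD1 !ltr_int; lia.
Qed.

Lemma cell_nonempty (R : realType) d (j k : int) : cell R d j k !=set0.
Proof.
have p2 : (0 : R) < 2 ^ j by apply: exprz_gt0.
exists ((k%:~R + offset R d j) / 2 ^ j); apply/in_cell.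
by rewrite mulrCA divff ?gt_eqF // mulr1 addrK lexx ltrDl ltr01.
Qed.

Lemma length_cell (R : realType) d (j k : int) :
  length (cell R d j k) = 2 ^ (- j).
Proof.
have p2 : (0 : R) < 2 ^ (- j) by apply: exprz_gt0.
rewrite /length lebesgue_measure_itv /= lte_fin ltr_pM2l // ifT; last lra.
by rewrite -EFinD /=; ring.
Qed.

Lemma pow2_inj (R : realType) (i j : int) :
  (2 : R) ^ (- i) = 2 ^ (- j) -> i = j.
Proof.
by move=> e; apply: oppr_inj; apply: ieexprIz e => //; rewrite (eqr_nat R 2 1).
Qed.

Lemma cell_inj (R : realType) d (j k j' k' : int) :
  cell R d j k = cell R d j' k' -> j = j' /\ k = k'.
Proof.
move=> e; have ej : j = j'.
  by apply: (@pow2_inj R); rewrite -(length_cell R d j k) e length_cell.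
split=> //; have [x xk] := cell_nonempty R d j k.
by apply: (cell_index xk); rewrite ej -e.
Qed.

Lemma translate_itvco (R : realType) (a b c a' b' : R) :
  a + c = a' -> b + c = b' ->
  translate `[a, b[%classic c = `[a', b'[%classic.
Proof.
move=> <- <-; apply/seteqP; split=> x /=.
  by move=> [y]; rewrite /= !in_itv /= => h <-; rewrite lerD2r ltrD2r.
rewrite in_itv /= => h; exists (x - c); last by rewrite subrK.
by rewrite /= in_itv /= lerBrDr ltrBlDr.
Qed.

Lemma tau_cell (R : realType) m d (j k : int) :
  tau m (cell R d j k) = cell R d j (k + m).
Proof.
by rewrite /tau length_cell; apply: translate_itvco; rewrite intrD; ring.
Qed.

Lemma third_shift_cell (R : realType) d (j k : int) :
  third_shift (cell R d j k) = (-1) ^ j * 2 ^ (- j) / 3.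
Proof.
apply: xget_unique; first by exists j => //; rewrite length_cell.
by move=> s [i]; rewrite length_cell => /pow2_inj -> ->.
Qed.

Lemma iter_sigma_cell (R : realType) (d : bool) (j k : int) :
  iter d (@sigma R) (cell R false j k) = cell R d j k.
Proof.
case: d => //=; rewrite /sigma third_shift_cell.
by apply: translate_itvco; rewrite /offset !mul0r mul1r; ring.
Qed.

(** * Inclusions between levels *)

Lemma sign_exprz (R : realType) (j : int) :
  exists2 e : int, e = 1 \/ e = -1 & (-1 : R) ^ j = e%:~R.
Proof.
case: j => n; rewrite /exprz -signr_odd; case: (odd _);
  by [ exists (-1); [right | rewrite ?invrN1]
     | exists 1; [left | rewrite ?invr1]].
Qed.

(** The alternating sign is what makes the shifted grid nested: since
    -2/3 = 1/3 - 1, doubling the offset of the parent level gives back the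
    offset of the level up to an integer. *)
Lemma offset_parent (R : realType) d (j : int) (e : int) :
  (-1 : R) ^ j = e%:~R ->
  2 * offset R d (j - 1) = offset R d j - (d%:Z * e)%:~R.
Proof.
move=> ej; have -> : (d%:Z * e)%:~R = d%:R * (-1 : R) ^ j by rewrite intrM ej.
rewrite /offset expfzDr ?oppr_eq0 ?oner_neq0 //.
have -> : (-1 : R) ^ (-1) = -1 by rewrite exprN1 invrN1.
by field.
Qed.

(** Iterating [offset_parent]: in units of level j, the endpoints of level j - r
    are the multiples of 2^r translated by an integer w. *)
Lemma offset_coarse (R : realType) d (j : int) (r : nat) :
  exists w : int, 2 ^+ r * offset R d (j - r%:Z) = offset R d j + w%:~R.
Proof.
elim: r => [|r [w ih]]; first by exists 0; rewrite subr0 mul1r addr0.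
have [e _ ej] := sign_exprz R (j - r%:Z).
exists (w - d%:Z * e * 2 ^+ r).
have -> : j - r.+1%:Z = j - r%:Z - 1 by lia.
rewrite exprSr -mulrA (offset_parent d ej) mulrBr ih.
rewrite intrB [in RHS]intrM rmorphXn /=; ring.
Qed.

Lemma cell_sub_coarse (R : realType) d (j : int) (r : nat) (w k : int) :
  2 ^+ r * offset R d (j - r%:Z) = offset R d j + w%:~R ->
  cell R d j k `<=` cell R d (j - r%:Z) ((k - w) %/ 2 ^+ r)%Z.
Proof.
move=> hw x /in_cell/andP[k1 k2]; apply/in_cell.
have N0 : (0 : int) < 2 ^+ r by apply: exprn_gt0.
have N0R : (0 : R) < 2 ^+ r by apply: exprn_gt0.
set l := ((k - w) %/ 2 ^+ r)%Z.
have l1 : l * 2 ^+ r + w <= k by rewrite -lerBrDr lez_floor // gt_eqF.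
have l2 : k + 1 <= (l + 1) * 2 ^+ r + w by rewrite lezD1 -ltrBlDr ltz_ceil.
rewrite -(ler_pM2l N0R) -(ltr_pM2l N0R) mulrBr hw mulrA.
rewrite expfzDr ?pnatr_eq0 // mulrCA -exprnN divff ?gt_eqF // mulr1.
move: l1 l2; rewrite -!(ler_int R) !intrD !intrM !rmorphXn /= => l1 l2.
by apply/andP; split; lra.
Qed.

(** * Two grids suffice *)

(** A change of quotient between k and k + m exhibits a point a N + w of the
    corresponding progression among n consecutive integers.  If this happens for
    both w0 and w1, the two points are at distance at most n - 1; but three
    times their difference is u N + e0 with u = 3 (a - b) - e1, and u is not
    divisible by 3, hence nonzero, which forces 3 (n - 1) >= N - 1. *)
Lemma two_grids_arith (N k m w0 w1 e0 e1 : int) :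
  (e0 = 1 \/ e0 = -1) -> (e1 = 1 \/ e1 = -1) ->
  0 < N -> 3 * `|m| < N -> w0 = 0 -> 3 * w1 = N * e1 - e0 ->
  ((k - w0) %/ N)%Z = ((k + m - w0) %/ N)%Z \/
  ((k - w1) %/ N)%Z = ((k + m - w1) %/ N)%Z.
Proof.
move=> e0P e1P N0 hp -> hw1.
have bd (w : int) : ((k - w) %/ N)%Z != ((k + m - w) %/ N)%Z ->
    exists a : int, (k < a * N + w <= k + m) || (k + m < a * N + w <= k).
  move=> ne.
  have f1 := lez_floor (k - w) (lt0r_neq0 N0).
  have f2 := ltz_ceil (k - w) N0.
  have f3 := lez_floor (k + m - w) (lt0r_neq0 N0).
  have f4 := ltz_ceil (k + m - w) N0.
  move: ne f1 f2 f3 f4; set a := (_ %/ _)%Z; set b := (_ %/ _)%Z.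
  clearbody a b => ne f1 f2 f3 f4.
  (* the larger quotient: its block starts after the smaller of k and k + m *)
  have [ab|ba] := ltP a b; [exists b | exists a].
    have {ab} : (a + 1) * N <= b * N by rewrite ler_pM2r // lezD1.
    move: f2 f3; move: ((a + 1) * N) (b * N) => A B; clear; lia.
  have {ba ne} : (b + 1) * N <= a * N.
    by rewrite ler_pM2r // lezD1 lt_neqAle eq_sym ne.
  move: f1 f4; move: ((b + 1) * N) (a * N) => A B; clear; lia.
have [|ne0] := eqVneq ((k - 0) %/ N)%Z ((k + m - 0) %/ N)%Z; first by left.
have [|ne1] := eqVneq ((k - w1) %/ N)%Z ((k + m - w1) %/ N)%Z; first by right.
exfalso.
have [a ha] := bd _ ne0; have [b hb] := bd _ ne1.
clear bd ne0 ne1.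
have uE : (3 * (a - b) - e1) * N + e0 = 3 * (a * N - b * N - w1).
  by rewrite (mulrBr 3 _ w1) hw1; ring.
have hu : N <= `|(3 * (a - b) - e1) * N|.
  rewrite normrM (gtr0_norm N0) ler_peMl ?(ltW N0) //.
  by case: e1P => ->; clear; lia.
move: uE hu ha hb; move: (_ * N) (a * N) (b * N) => U A B.
clear hw1 e1P; case: e0P => ->; lia.
Qed.

Definition fits (R : realType) (d : bool) (p : nat) (m j k : int) : Prop :=
  exists l, cell R d j k `|` cell R d j (k + m) `<=` cell R d (j - p%:Z) l.

Arguments fits R d p m j k : clear implicits.

(** The signs e0 and e1 are those of the shifts at levels j and j - p.  In the
    unshifted grid the endpoints of level j - p are exactly the multiples of
    2^p, i.e. w0 = 0. *)
Lemma fits_shifted (R : realType) (p : nat) (m j k : int) :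
  3 * `|m| < 2 ^+ p -> ~ fits R false p m j k -> fits R true p m j k.
Proof.
move=> hp unfit.
have [w0 h0] := offset_coarse R false j p.
have [w1 h1] := offset_coarse R true j p.
have [e0 e0P e0E] := sign_exprz R j.
have [e1 e1P e1E] := sign_exprz R (j - p%:Z).
have w0E : w0 = 0.
  apply/eqP; rewrite -(intr_eq0 R); move: h0.
  by rewrite /offset !mul0r mulr0 add0r => <-.
have w1E : 3 * w1 = 2 ^+ p * e1 - e0.
  apply: (@intr_inj R); rewrite intrB !intrM rmorphXn /=.
  by move: h1; rewrite /offset !mul1r e0E e1E; lra.
have N0 : (0 : int) < 2 ^+ p by apply: exprn_gt0.
have fit d w : 2 ^+ p * offset R d (j - p%:Z) = offset R d j + w%:~R ->
    ((k - w) %/ 2 ^+ p)%Z = ((k + m - w) %/ 2 ^+ p)%Z -> fits R d p m j k.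
  move=> hw e; exists ((k - w) %/ 2 ^+ p)%Z; rewrite subUset; split.
    exact: cell_sub_coarse.
  by rewrite e; apply: cell_sub_coarse.
have [/(fit _ _ h0)/unfit //|/(fit _ _ h1)//] :=
  two_grids_arith k e0P e1P N0 hp w0E w1E.
Qed.

(** * Nestedness *)

Definition member (R : realType) (m : int) d (j k : int) (A : set R) : Prop :=
  A = cell R d j k \/ A = cell R d j (k + m) \/
  A = cell R d j k `|` cell R d j (k + m).

Lemma member_sub (R : realType) m d (j k : int) (A : set R) :
  member m d j k A -> A `<=` cell R d j k `|` cell R d j (k + m).
Proof. by case=> [|[|]] ->; [left | right | ]. Qed.

Lemma cell_cases (R : realType) d (j k l : int) :
  cell R d j k `&` cell R d j l = set0 \/ k = l.
Proof.
have [|/eqP/set0P[x [xk xl]]] := EM (cell R d j k `&` cell R d j l = set0).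
  by left.
by right; apply: cell_index xk xl.
Qed.

Lemma member_split (R : realType) m d (j k l : int) (A : set R) :
  member m d j k A ->
  A `&` cell R d j l = set0 \/ cell R d j l `<=` A.
Proof.
rewrite /member; have [k0|->] := cell_cases R d j k l; last first.
  have [k1|->] := cell_cases R d j (l + m) l.
    by case=> [|[|]] ->; [right | left | right; left].
  by case=> [|[|]] ->; right => //; left.
have [k1|->] := cell_cases R d j (k + m) l; last first.
  by case=> [|[|]] ->; [left | right | right; right].
by case=> [|[|]] ->; left; rewrite // setIUl k0 k1 setU0.
Qed.

(** Everything attached to the finer interval lies in a cell of level j' - p,
    hence in a cell of the coarser level j, to which [member_split] applies. *)
Lemma nested_finer (R : realType) m d p (j k j' k' : int) (q : nat)
    (A A' : set R) :
  j = j' - p%:Z - q%:Z -> fits R d p m j' k' ->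
  member m d j k A -> member m d j' k' A' ->
  A `&` A' = set0 \/ A' `<=` A.
Proof.
move=> jE [l fit] hA /member_sub/subset_trans/(_ fit) A'l.
have [w hw] := offset_coarse R d (j' - p%:Z) q.
have := cell_sub_coarse (k := l) hw; rewrite -jE => /(subset_trans A'l) {}A'l.
case: (member_split ((l - w) %/ 2 ^+ q)%Z hA) => h; last first.
  by right; apply: subset_trans h.
by left; rewrite -subset0 -h; apply: setIS.
Qed.

Lemma nested_same_level (R : realType) m d (j k k' : int) (A A' : set R) :
  k != k' + m -> k' != k + m ->
  member m d j k A -> member m d j k' A' ->
  A `&` A' = set0 \/ A `<=` A' \/ A' `<=` A.
Proof.
move=> n1 n2 hA hA'; have [kk|nk] := eqVneq k k'.
  subst k'; case: hA => [|[|]] ->; last by right; right; apply: member_sub hA'.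
    by rewrite setIC; case: (member_split k hA'); [left | right; left].
  by rewrite setIC; case: (member_split (k + m) hA'); [left | right; left].
left; rewrite -subset0 => x [/(member_sub hA) xk /(member_sub hA') xk'].
have [a [b [akb]]] :
    exists a b, a != b /\ cell R d j a x /\ cell R d j b x.
  case: xk xk' => xk [] xk';
    do 2 eexists; (split; last by split; [exact: xk | exact: xk']) => //.
  - by rewrite eq_sym.
  - by rewrite (inj_eq (addIr m)).
by case=> xa xb; rewrite (cell_index xa xb) eqxx in akb.
Qed.

(** * Colouring *)

(** The pair (j mod p, parity of the quotient of k by m), packed into a single
    number below 2p. *)
Definition colour (p : nat) (m j k : int) : nat :=
  (`|(j %% p)%Z| * 2 + `|((k %/ m)%Z %% 2)%Z|)%N.

Lemma colour_lt p m j k : (0 < p)%N -> (colour p m j k < p * 2)%N.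
Proof.
move=> p0; rewrite /colour.
have := ltz_pmod j (d := p) p0; have := modz_ge0 j (d := p).
have := ltz_pmod (k %/ m)%Z (d := 2) isT; have := modz_ge0 (k %/ m)%Z (d := 2).
lia.
Qed.

Lemma colour_inj p m j k j' k' : (0 < p)%N ->
  colour p m j k = colour p m j' k' ->
  (j %% p)%Z = (j' %% p)%Z /\ ((k %/ m)%Z %% 2)%Z = ((k' %/ m)%Z %% 2)%Z.
Proof.
move=> p0; rewrite /colour.
have := modz_ge0 j (d := p); have := modz_ge0 j' (d := p).
have := ltz_pmod (k %/ m)%Z (d := 2) isT; have := modz_ge0 (k %/ m)%Z (d := 2).
have := ltz_pmod (k' %/ m)%Z (d := 2) isT.
have := modz_ge0 (k' %/ m)%Z (d := 2).
move: (_ %% 2)%Z (_ %% 2)%Z (_ %% p)%Z (_ %% p)%Z => a b c e.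
lia.
Qed.

(** Translating the index by m adds one to the quotient by m. *)
Lemma parity_neighbour (m k k' : int) : m != 0 ->
  ((k %/ m)%Z %% 2)%Z = ((k' %/ m)%Z %% 2)%Z -> k != k' + m.
Proof.
move=> m0 e; apply/eqP => kE; move: e.
have -> : (k %/ m)%Z = 1 + (k' %/ m)%Z.
  by rewrite kE addrC -[m in m + _]mul1r divzMDl.
by move: (_ %/ m)%Z => a; lia.
Qed.

Lemma nested_class (R : realType) m d p (F : set (set R)) :
  m != 0 -> (0 < p)%N ->
  (forall I J, F I -> F J -> exists j k j' k' : int,
     [/\ I = cell R d j k /\ J = cell R d j' k', fits R d p m j k,
         fits R d p m j' k' & colour p m j k = colour p m j' k']) ->
  nested (with_translates m F).
Proof.
move=> m0 p0 HF A A' [I FI hA] [J FJ hA'].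
have [j [k [j' [k' [[IE JE] fit fit' c]]]]] := HF _ _ FI FJ.
rewrite IE tau_cell -/(member m d j k A) in hA.
rewrite JE tau_cell -/(member m d j' k' A') in hA'.
have [ej ek] := colour_inj p0 c.
(* congruent distinct levels are at least p apart *)
have step (i i' : int) : i < i' -> (i %% p)%Z = (i' %% p)%Z ->
    exists q : nat, i = i' - p%:Z - q%:Z.
  move=> ii' /esym/eqP; rewrite eqz_mod_dvd => /dvdzP[s sE].
  have s0 : 0 < s by rewrite -(pmulr_lgt0 _ (_ : 0 < p%:Z)) // -sE subr_gt0.
  exists (`|s - 1| * p)%N; rewrite PoszM gez0_abs; last by rewrite subr_ge0.
  by rewrite mulrBl -sE; ring.
have [jj'|j'j|jj'] := ltgtP j j'.
- have [q qE] := step _ _ jj' ej.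
  by case: (nested_finer qE fit' hA hA'); [left | right; right].
- have [q qE] := step _ _ j'j (esym ej).
  by rewrite setIC; case: (nested_finer qE fit hA' hA); [left | right; left].
subst j'; apply: nested_same_level hA hA'; exact: parity_neighbour.
Qed.

(** * The decomposition *)

Lemma trunc_log_le_log2 (R : realType) (n : nat) :
  (0 < n)%N -> (trunc_log 2 n)%:R <= log2 (n%:R : R).
Proof.
move=> n0; have l2 : 0 < ln (2 : R) by rewrite ln_gt0 // ltr1n.
rewrite /log2 ler_pdivlMr // mulr_natl -lnXn //.
rewrite ler_ln ?posrE ?exprn_gt0 ?ltr0n // -natrX ler_nat.
by apply: trunc_logP.
Qed.

(* In [iter delta _ _] the boolean delta is coerced to 0 or 1. *)
Theorem lemma4p1 (R : realType) (m : int) (hm : m != 0) :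
  exists K : nat,
    K%:R <= 7 + 2 * log2 (`|m|%:~R : R) /\
    exists B : 'I_K.+1 -> bool -> set (set R),
      [/\ (forall (i : 'I_K.+1) (delta : bool), B i delta `<=` @dyadic R),
          trivIset [set: 'I_K.+1 * bool] (fun p => B p.1 p.2),
          @dyadic R = \bigcup_(delta in [set: bool])
                        \bigcup_(i in [set: 'I_K.+1]) B i delta
        & forall (i : 'I_K.+1) (delta : bool),
            nested (with_translates m
              [set iter delta (@sigma R) I | I in B i delta])].
Proof.
have n0 : (0 < `|m|)%N by rewrite absz_gt0.
set lam := trunc_log 2 `|m|.
pose p := lam.+3; exists (lam * 2 + 5)%N.
have KE : (lam * 2 + 5).+1 = (p * 2)%N by rewrite /p; lia.
have hp : 3 * `|m| < 2 ^+ p.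
  have := trunc_log_ltn `|m|%N (isT : 1 < 2)%N; rewrite -/lam => h.
  have -> : (2 : int) ^+ p = (4 * 2 ^ lam.+1)%N%:Z.
    by rewrite PoszM -natrX; rewrite /p !expnS; lia.
  by lia.
split.
  have := trunc_log_le_log2 R n0; rewrite -/lam natrD natrM.
  have -> : (`|m|%:~R : R) = `|m|%N%:R by rewrite -abszE.
  by move: (lam%:R) (log2 _) => a b; lra.
(* I goes to the shifted grid exactly when it does not fit in the plain one *)
pose B (i : 'I_(lam * 2 + 5).+1) (delta : bool) : set (set R) :=
  [set I | exists j k : int, [/\ I = cell R false j k,
    i = colour p m j k :> nat & delta = ~~ `[< fits R false p m j k >]]].
have BI i d I : B i d I -> @dyadic R I.
  by rewrite dyadicE => -[j [k [-> _ _]]]; exists j, k.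
exists B; split.
- by move=> i d I; apply: BI.
- move=> [i d] [i' d'] _ _ [I [/= [j [k [IE iE dE]]] [j' [k' [IE' iE' dE']]]]].
  move: IE'; rewrite IE => /cell_inj[jE kE]; subst j' k'.
  by congr (_, _); [apply: val_inj; rewrite /= iE | rewrite dE].
- apply/seteqP; split=> I; last by move=> [d _ [i _ /BI]].
  rewrite dyadicE => -[j [k IE]].
  have cK : (colour p m j k < (lam * 2 + 5).+1)%N by rewrite KE colour_lt.
  exists (~~ `[< fits R false p m j k >]) => //.
  by exists (Ordinal cK) => //; exists j, k.
move=> i d; apply: (@nested_class R m d p) => // I J.
move=> [_ [j [k [-> iE dE]]] <-] [_ [j' [k' [-> iE' dE']]] <-].
exists j, k, j', k'; rewrite !iter_sigma_cell -iE -iE'.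
have fit x y : d = ~~ `[< fits R false p m x y >] -> fits R d p m x y.
  case: d {dE dE'} => /esym; first by move/asboolPn; apply: fits_shifted.
  by move/negbFE/asboolP.
by split=> //; apply: fit.
Qed.
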